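(* Let $q\geqslant 2$ be an integer and let $f$ be a real-valued $q$-additive function such that the two series \[ \sum_{j\geqslant 0}\sum_{d=1}^{q-1}f(dq^j)\quad\text{and}\quad \sum_{j\geqslant 0}\sum_{d=1}^{q-1}f(dq^j)^2 \] converge and such that $f(dq^j)\neq 0$ for infinitely many pairs $(d,j)$ with $1\leqslant d\leqslant q-1$, $j\geqslant 0$. Let $F$ be the limiting distribution function of $f$, i.e. $F(y)=\lim_{N\to\infty}F_N(y)$. For an integer $N\geqslant 1$ set $L=\lfloor \log_q N\rfloor$. Then for all real numbers $T\geqslant 1$ such that $h=\lceil \log_q(T\log T)\rceil\leqslant L$ we have \[ \|F_N-F\|_\infty \ll Q_F\!\left(\frac1T\right) + T\left|\sum_{j>L}\sum_{d=0}^{q-1} f(dq^j)\right| + T\sqrt{h}\,\sqrt{\sum_{j\geqslant L-h}\sum_{d=0}^{q-1} f(dq^j)^2}, \] where the implicit constant depends on $q$.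
   Context: A function $f:\mathbb{Z}_{\geqslant 0}\to\mathbb{R}$ is $q$-additive if $f(0)=0$ and $f(d_1q^{e_1}+\cdots+d_rq^{e_r})=f(d_1q^{e_1})+\cdots+f(d_rq^{e_r})$ whenever $0\leqslant e_1<\cdots<e_r$ are distinct integers and $d_1,\dots,d_r\in\{1,\dots,q-1\}$; in particular $f(0\cdot q^j)=0$. $F_N(y)=\frac1N\#\{n<N: f(n)\leqslant y\}$ is the distribution function of $(f(n):n<N)$, $\|\cdot\|_\infty$ is the sup norm over $y\in\mathbb{R}$, and $Q_F(h)=\sup_{z\in\mathbb{R}}(F(z+h)-F(z))$ for $h>0$ is the concentration function.
   Formalization: The implicit constant is allowed to depend on f as well as on q (it is uniform in N and T), because the bound with a constant depending on q alone is false. *)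

(* Defs.v *)
(* MathComp-Analysis, over an arbitrary R : realType. *)
From HB Require Import structures.
From mathcomp Require Import all_boot all_order all_algebra.
From mathcomp Require Import all_classical all_reals all_analysis.

Set Implicit Arguments.
Unset Strict Implicit.
Unset Printing Implicit Defensive.

Import Order.TTheory GRing.Theory Num.Theory.
Import numFieldNormedType.Exports.

Local Open Scope classical_set_scope.
Local Open Scope ring_scope.

Definition q_additive (R : realType) (q : nat) (f : nat -> R) : Prop :=
  f 0%N = 0 /\
  forall (r : nat) (d e : 'I_r -> nat),
    (forall i j : 'I_r, (i < j)%N -> (e i < e j)%N) ->
    (forall i : 'I_r, (1 <= d i <= q.-1)%N) ->
    f (\sum_(i < r) d i * q ^ e i)%N = \sum_(i < r) f (d i * q ^ e i)%N.

Definition distr_fun (R : realType) (f : nat -> R) (N : nat) (y : R) : R :=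
  N%:R^-1 * #|[pred n : 'I_N | f n <= y]|%:R.

(* The real [sup] below is 0 on a set that is not bounded above. Neither
   definition meets this case when it is applied to (differences of)
   functions with values in [0, 1]. *)
Definition sup_norm (R : realType) (g : R -> R) : R :=
  sup (range (fun y => `|g y|)).

Definition concentration (R : realType) (F : R -> R) (h : R) : R :=
  sup (range (fun z => F (z + h) - F z)).

(* [ln] is 0 on nonpositive arguments, so [log_base q 0 = 0]. *)
Definition log_base (R : realType) (q : nat) (x : R) : R := ln x / ln q%:R.

(* Main.v *)
(* Write n = a q^K + m with m < q^K, so that f(n) = f(a q^K) + f(m), and let G be
   the distribution function of (f(m) : m < q^K), with K = L - h.  Up to a
   proportion q^-h <= 1/T of its elements, [0, N) is a union of translates of
   [0, q^K), and so is [0, q^M) for every M >= K.  By Markov's inequality F_N(y)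
   and F(y) both lie between G(y - 1/T) and G(y + 1/T), up to T times the mean of
   |f(a q^K)|.  That mean is bounded through the first two moments of f(a q^K),
   a < q^m, whose digits are independent.  Comparing with F at y + 2/T and
   y - 2/T eliminates G at the cost of 2 Q_F(1/T).
   Finally 1/T << Q_F(1/T) because F is not constant; since the constant may
   depend on f, this also covers the bounded range T < e. *)
Require Import Defs.
From mathcomp Require Import all_boot all_order all_algebra.
From mathcomp Require Import all_classical all_reals all_analysis.
From mathcomp Require Import zify ring lra.
Import Order.TTheory GRing.Theory Num.Theory.
Import numFieldNormedType.Exports.

Local Open Scope classical_set_scope.
Local Open Scope ring_scope.

(** * Finite sums, variance and the Cauchy-Schwarz inequality *)

Lemma sum_blocks (R : realType) (A B : nat) (g : nat -> R) :
  \sum_(0 <= i < A * B) g i =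
  \sum_(0 <= a < A) \sum_(0 <= m < B) g (a * B + m)%N.
Proof.
rewrite big_nat_mul; apply: eq_bigr => a _.
rewrite -[X in \sum_(X <= _ < _) _]add0n big_addn.
by rewrite mulSn addnK; apply: eq_bigr => m _; rewrite addnC.
Qed.

Lemma sum_const_nat (R : realType) (n : nat) (c : R) :
  \sum_(0 <= i < n) c = n%:R * c.
Proof. by rewrite big_const_nat subn0 iter_addr_0 mulr_natl. Qed.

Lemma sum_nat_shift (R : realType) (K n : nat) (g : nat -> R) :
  \sum_(K <= j < K + n) g j = \sum_(0 <= j < n) g (K + j)%N.
Proof.
rewrite -[X in \sum_(X <= _ < _) _]add0n big_addn addKn.
by apply: eq_bigr => j _; rewrite addnC.
Qed.

Section SquareSums.
Variables (R : realType) (n : nat) (g : nat -> R).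

Lemma sum_center_sqr (c : R) : n%:R * c = \sum_(0 <= i < n) g i ->
  \sum_(0 <= i < n) (g i - c) ^+ 2 =
  \sum_(0 <= i < n) g i ^+ 2 - n%:R * c ^+ 2.
Proof.
move=> hc.
under eq_bigr => i _ do rewrite sqrrB.
rewrite !big_split /= sumrN sum_const_nat.
have -> : \sum_(0 <= i < n) g i * c *+ 2 = (n%:R * c) * c *+ 2.
  by rewrite hc mulr_suml -sumrMnl.
ring.
Qed.

(** Cauchy-Schwarz against the constant 1, read off from the nonnegativity of the sum of squares
    about the mean. *)
Lemma sqr_sum_le : (\sum_(0 <= i < n) g i) ^+ 2 <=
  n%:R * \sum_(0 <= i < n) g i ^+ 2.
Proof.
case: (posnP n) => [->|n0]; first by rewrite !big_geq // expr0n mul0r.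
have nR : (0 : R) < n%:R by rewrite ltr0n.
pose c := n%:R^-1 * \sum_(0 <= i < n) g i.
have hc : n%:R * c = \sum_(0 <= i < n) g i by rewrite mulVKf // gt_eqF.
have : 0 <= \sum_(0 <= i < n) (g i - c) ^+ 2.
  by apply: sumr_ge0 => i _; exact: sqr_ge0.
rewrite (sum_center_sqr _ hc) subr_ge0 -hc => h.
by rewrite exprMn expr2 -mulrA ler_wpM2l // ltW.
Qed.

End SquareSums.

Lemma sum_norm_le (R : realType) (n : nat) (g : nat -> R) (s : R) : 0 <= s ->
  \sum_(0 <= i < n) g i ^+ 2 <= n%:R * s ->
  \sum_(0 <= i < n) `|g i| <= n%:R * Num.sqrt s.
Proof.
move=> s0 hs.
rewrite -(@ler_pXn2r _ 2) ?nnegrE ?mulr_ge0 ?sqrtr_ge0 //; last first.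
  by apply: sumr_ge0.
rewrite exprMn sqr_sqrtr //.
apply: le_trans (sqr_sum_le _ _ _) _.
rewrite expr2 -mulrA ler_wpM2l //.
by under eq_bigr => i _ do rewrite real_normK ?num_real //.
Qed.

(** * Base-$q$ digits and the first two moments of $f(bq^K)$ *)

Section Additive.
Variables (R : realType) (q : nat).
Hypothesis q2 : (2 <= q)%N.
Variable f : nat -> R.
Hypothesis hf : q_additive q f.

Lemma q_additive0 : f 0%N = 0. Proof. by case: hf. Qed.

(** Zero digits are skipped, because [q_additive] speaks only of digits in $1,\dots,q-1$. Digits and
    exponents are total functions, so that a leading digit can be appended without casts between
    ordinals. *)
Lemma digits_rep (K m : nat) : (m < q ^ K)%N ->
  exists (r : nat) (d e : nat -> nat),
  [/\ forall i j, (i < j < r)%N -> (e i < e j)%N,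
      forall i, (i < r)%N -> (1 <= d i <= q.-1)%N,
      forall i, (i < r)%N -> (e i < K)%N &
      m = (\sum_(i < r) d i * q ^ e i)%N].
Proof.
elim: K m => [|K IH] m hm.
  exists 0%N, (fun=> 0%N), (fun=> 0%N); split=> //; first by move=> i j; lia.
  by rewrite big_ord0; move: hm; rewrite expn0; lia.
have qK : (0 < q ^ K)%N by rewrite expn_gt0; lia.
have [r [d [e [h1 h2 h3 h4]]]] := IH _ (ltn_pmod m qK).
have hd : (m %/ q ^ K < q)%N by rewrite ltn_divLR // -expnS.
case: (posnP (m %/ q ^ K)) => [d0|d0].
  exists r, d, e; split=> //; first by move=> i /h3; lia.
  by rewrite -h4 {1}(divn_eq m (q ^ K)) d0.
exists r.+1, (fun i => if (i < r)%N then d i else m %/ q ^ K)%N,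
  (fun i => if (i < r)%N then e i else K); split.
- move=> i j ij; case: ifP => ir; case: ifP => jr; try lia.
    by apply: h1; lia.
  by have := h3 _ ir; lia.
- by move=> i _; case: ifP => [/h2//|_]; lia.
- by move=> i _; case: ifP => [/h3|_]; lia.
rewrite big_ord_recr /= ltnn.
under eq_bigr => i _ do rewrite ltn_ord.
by rewrite -h4 addnC -divn_eq.
Qed.

Lemma q_additive_digit (K d m : nat) : (d < q)%N -> (m < q ^ K)%N ->
  f (d * q ^ K + m)%N = f (d * q ^ K)%N + f m.
Proof.
move=> hd hm; case: (posnP d) => [->|d0].
  by rewrite mul0n add0n q_additive0 add0r.
have [r [ds [e [h1 h2 h3 ->]]]] := digits_rep _ _ hm.
case: hf => _ hf2.
rewrite (hf2 _ (fun i : 'I_r => ds i) (fun i => e i)); first last.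
- by move=> i; apply: h2.
- by move=> i j ij; apply: h1; rewrite ij /=.
pose d' i := if (i < r)%N then ds i else d.
pose e' i := if (i < r)%N then e i else K.
have := hf2 r.+1 (fun i => d' i) (fun i => e' i).
have lt_r (i : 'I_r) : d' i = ds i /\ e' i = e i by rewrite /d' /e' ltn_ord.
have [d'r e'r] : d' r = d /\ e' r = K by rewrite /d' /e' ltnn.
rewrite !big_ord_recr /= d'r e'r.
have -> : (\sum_(i < r) d' i * q ^ e' i = \sum_(i < r) ds i * q ^ e i)%N.
  by apply: eq_bigr => i _; have [-> ->] := lt_r i.
have -> : \sum_(i < r) f (d' i * q ^ e' i)%N = \sum_(i < r) f (ds i * q ^ e i)%N.
  by apply: eq_bigr => i _; have [-> ->] := lt_r i.
rewrite addnC addrC => -> //.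
- move=> i j ij; have := ltn_ord j => jr; rewrite /e'.
  case: ifP => ir; case: ifP => jr'; try lia.
    by apply: h1; lia.
  by have := h3 _ ir; lia.
- by move=> i; rewrite /d'; case: ifP => [/h2//|_]; lia.
Qed.

(** Induction on the number of digits of $a$: the leading digit is split off both from $aq^K+m$ and
    from $aq^K$. *)
Lemma q_additive_split (K a m : nat) : (m < q ^ K)%N ->
  f (a * q ^ K + m)%N = f (a * q ^ K)%N + f m.
Proof.
move=> hm.
(* Any bound on the number of digits of $a$ starts the induction; $a$ itself will do. *)
have : (a < q ^ a)%N by apply: ltn_expl.
move: {2}a => t; elim: t a => [|t IH] a ha.
  have -> : a = 0%N by move: ha; rewrite expn0; lia.
  by rewrite mul0n add0n q_additive0 add0r.
have qt : (0 < q ^ t)%N by rewrite expn_gt0; lia.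
have hd : (a %/ q ^ t < q)%N by rewrite ltn_divLR // -expnS.
have hr := ltn_pmod a qt.
rewrite (divn_eq a (q ^ t)); set d := (a %/ _)%N; set r := (a %% _)%N.
rewrite !mulnDl -mulnA -expnD -addnA.
have rK (b : nat) : (b < q ^ K)%N -> (r * q ^ K + b < q ^ (t + K))%N.
  move=> hb; apply: (@leq_trans (r.+1 * q ^ K)%N); first by rewrite mulSn; lia.
  by rewrite expnD leq_mul2r hr orbT.
have rK0 : (r * q ^ K < q ^ (t + K))%N.
  by rewrite -[X in (X < _)%N]addn0 rK // expn_gt0; lia.
rewrite (q_additive_digit _ d (r * q ^ K + m)) ?rK //.
by rewrite (q_additive_digit _ d (r * q ^ K)) // (IH _ hr) addrA.
Qed.

Definition digit_sum (j : nat) : R := \sum_(0 <= d < q) f (d * q ^ j)%N.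
Definition digit_sqr (j : nat) : R := \sum_(0 <= d < q) f (d * q ^ j)%N ^+ 2.

Lemma digit_sqr_ge0 (j : nat) : 0 <= digit_sqr j.
Proof. by apply: sumr_ge0 => d _; exact: sqr_ge0. Qed.

Let qR : (0 : R) < q%:R. Proof. by rewrite ltr0n; lia. Qed.

Lemma block_split (K m a b : nat) : (b < q ^ m)%N ->
  f ((a * q ^ m + b) * q ^ K)%N = f (a * q ^ (K + m))%N + f (b * q ^ K)%N.
Proof.
move=> hb; rewrite mulnDl -mulnA -expnD addnC [(m + K)%N]addnC addnC.
rewrite q_additive_split // expnD mulnC ltn_pmul2l //.
by rewrite expn_gt0; lia.
Qed.

Lemma first_moment (K m : nat) :
  \sum_(0 <= b < q ^ m) f (b * q ^ K)%N =
  (q ^ m)%:R * (q%:R^-1 * \sum_(0 <= j < m) digit_sum (K + j)).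
Proof.
elim: m => [|m IH].
  by rewrite expn0 big_nat1 mul0n q_additive0 big_geq // !mulr0.
rewrite expnS sum_blocks big_nat_recr //=.
under eq_bigr => a _.
  under eq_big_nat => b hb do rewrite block_split //.
  rewrite big_split /= IH sum_const_nat; over.
rewrite big_split /= sum_const_nat -mulr_sumr -/(digit_sum (K + m)).
rewrite natrM; field; exact: lt0r_neq0.
Qed.

(** For uniform $b<q^m$ the digits are independent, so the variance of $f(bq^K)$ is the sum of the
    variances of the digit contributions, each at most the corresponding second moment. *)
Lemma second_moment (K m : nat) :
  \sum_(0 <= b < q ^ m)
    (f (b * q ^ K)%N - q%:R^-1 * \sum_(0 <= j < m) digit_sum (K + j)) ^+ 2 <=
  (q ^ m)%:R * (q%:R^-1 * \sum_(0 <= j < m) digit_sqr (K + j)).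
Proof.
elim: m => [|m IH].
  by rewrite expn0 big_nat1 mul0n q_additive0 !big_geq // !mulr0 subr0 expr0n.
rewrite expnS sum_blocks !big_nat_recr //=.
set c := q%:R^-1 * \sum_(0 <= j < m) digit_sum (K + j) in IH *.
set v := q%:R^-1 * _ in IH.
pose c' := q%:R^-1 * digit_sum (K + m).
have hc' : q%:R * c' = digit_sum (K + m) by rewrite mulVKf // gt_eqF.
(* Independence enters here: the lower digits are centered, so the cross terms with the new digit
   cancel. *)
have sc : \sum_(0 <= b < q ^ m) (f (b * q ^ K)%N - c) = 0.
  by rewrite sumrB first_moment sum_const_nat subrr.
set C := q%:R^-1 * (_ + digit_sum _).
have block a : \sum_(0 <= b < q ^ m) (f ((a * q ^ m + b) * q ^ K)%N - C) ^+ 2 =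
  (q ^ m)%:R * (f (a * q ^ (K + m))%N - c') ^+ 2 +
  \sum_(0 <= b < q ^ m) (f (b * q ^ K)%N - c) ^+ 2.
  set x := f (a * q ^ (K + m))%N - c'.
  transitivity (\sum_(0 <= b < q ^ m) (x ^+ 2 + (x *+ 2) * (f (b * q ^ K)%N - c)
    + (f (b * q ^ K)%N - c) ^+ 2)).
    by apply: eq_big_nat => b hb; rewrite block_split // /x /C /c /c'; ring.
  by rewrite !big_split /= -[X in _ + X + _]mulr_sumr sc mulr0 addr0 sum_const_nat.
under eq_bigr => a _ do rewrite block.
rewrite big_split /= sum_const_nat -mulr_sumr.
rewrite (sum_center_sqr _ _ _ _ hc') -/(digit_sqr (K + m)).
rewrite [X in _ <= _ * X]mulrDr -/v natrM.
have e0 : 0 <= (q ^ m)%:R * (q%:R * c' ^+ 2) :> R.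
  by rewrite mulr_ge0 ?ler0n // mulr_ge0 ?sqr_ge0 ?ler0n.
have -> : q%:R * (q ^ m)%:R * (v + q%:R^-1 * digit_sqr (K + m)) =
   (q ^ m)%:R * digit_sqr (K + m) + q%:R * ((q ^ m)%:R * v).
  by field; exact: lt0r_neq0.
by apply: lerD; [rewrite mulrBr gerBl | rewrite ler_wpM2l // ltW].
Qed.

(** The mean of $|f|$ is at most |mean| plus standard deviation; the factors $1/q$ from the moments
    are bounded by 1. *)
Lemma sum_norm_block (K m : nat) :
  \sum_(0 <= b < q ^ m) `|f (b * q ^ K)%N| <=
  (q ^ m)%:R * (`|\sum_(0 <= j < m) digit_sum (K + j)| +
                Num.sqrt (\sum_(0 <= j < m) digit_sqr (K + j))).
Proof.
have s0 : 0 <= \sum_(0 <= j < m) digit_sqr (K + j).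
  by apply: sumr_ge0 => j _; exact: digit_sqr_ge0.
have q1 : q%:R^-1 <= 1 :> R by rewrite invf_le1 // ler1n; lia.
have qi0 : 0 <= q%:R^-1 :> R by rewrite invr_ge0 ltW.
set c := q%:R^-1 * \sum_(0 <= j < m) digit_sum (K + j).
have hv : \sum_(0 <= b < q ^ m) `|f (b * q ^ K)%N - c| <=
    (q ^ m)%:R * Num.sqrt (\sum_(0 <= j < m) digit_sqr (K + j)).
  apply: (sum_norm_le _ _ (fun b => f (b * q ^ K)%N - c)) => //.
  by apply: le_trans (second_moment K m) _; rewrite ler_wpM2l // ler_piMl.
apply: (@le_trans _ _ (\sum_(0 <= b < q ^ m) (`|c| + `|f (b * q ^ K)%N - c|))).
  by apply: ler_sum => b _; rewrite -[X in `|X| <= _](subrKC c) ler_normD.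
rewrite big_split /= sum_const_nat mulrDr lerD // ler_wpM2l //.
by rewrite normrM ger0_norm // ler_piMl.
Qed.

(** Cauchy-Schwarz twice: over the $m$ positions, then over the $q$ digits at each position. *)
Lemma digit_sum_CS (K m : nat) :
  `|\sum_(0 <= j < m) digit_sum (K + j)| <=
  Num.sqrt (m%:R * q%:R * \sum_(0 <= j < m) digit_sqr (K + j)).
Proof.
rewrite -sqrtr_sqr ler_sqrt; last first.
  by rewrite !mulr_ge0 // sumr_ge0 // => j _; exact: digit_sqr_ge0.
apply: le_trans (sqr_sum_le _ _ _) _.
rewrite -mulrA ler_wpM2l // mulr_sumr ler_sum // => j _.
exact: sqr_sum_le.
Qed.

End Additive.

(** * Counting functions and empirical distribution functions *)

Section Counting.
Variables (R : realType) (f : nat -> R).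

Definition count_le (N : nat) (y : R) : R := \sum_(0 <= n < N) (f n <= y)%R%:R.

Lemma distr_funE (N : nat) (y : R) : distr_fun f N y = N%:R^-1 * count_le N y.
Proof.
rewrite /distr_fun /count_le -sum1_card natr_sum big_mkord big_mkcond /=.
by congr (_ * _); apply: eq_bigr => i _; rewrite inE; case: ifP.
Qed.

Lemma count_leE (N : nat) (y : R) : (0 < N)%N ->
  count_le N y = N%:R * distr_fun f N y.
Proof. by move=> N0; rewrite distr_funE mulVKf // pnatr_eq0; lia. Qed.

Lemma count_le_ge0 (N : nat) (y : R) : 0 <= count_le N y.
Proof. exact: sumr_ge0. Qed.

Lemma count_le_ub (N : nat) (y : R) : count_le N y <= N%:R.
Proof.
rewrite -[X in _ <= X]mulr1 -sum_const_nat ler_sum // => n _.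
by rewrite lern1 leq_b1.
Qed.

Lemma distr_fun_ge0 (N : nat) (y : R) : 0 <= distr_fun f N y.
Proof. by rewrite distr_funE mulr_ge0 ?invr_ge0 ?ler0n ?count_le_ge0. Qed.

Lemma distr_fun_le1 (N : nat) (y : R) : distr_fun f N y <= 1.
Proof.
case: (posnP N) => [->|N0]; first by rewrite distr_funE invr0 mul0r ler01.
by rewrite distr_funE ler_pdivrMl ?ltr0n // mulr1 count_le_ub.
Qed.

Lemma distr_fun_homo (N : nat) : {homo distr_fun f N : x y / x <= y}.
Proof.
move=> x y xy; rewrite !distr_funE ler_wpM2l ?invr_ge0 // ler_sum // => n _.
by rewrite ler_nat; have [h|//] := leP (f n) x; rewrite (le_trans h xy).
Qed.

Lemma count_le_cat (M N : nat) (y : R) : (M <= N)%N ->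
  count_le M y <= count_le N y <= count_le M y + (N - M)%:R.
Proof.
move=> MN; rewrite {2 3}/count_le (big_cat_nat (n := M)) //= -/(count_le M y).
rewrite lerDl sumr_ge0 //= lerD2l.
rewrite -[X in _ <= X]mulr1 -sum_const_nat -[X in \sum_(X <= _ < _) _]add0n.
rewrite big_addn ler_sum // => n _.
by rewrite lern1 leq_b1.
Qed.

(** Markov's inequality at a single point: if $u\leqslant y$ but $v>y+d$, then $|v-u|>d$. *)
Lemma indicator_shift (u v y d : R) : 0 < d ->
  (u <= y)%R%:R <= (v <= y + d)%R%:R + d^-1 * `|v - u|.
Proof.
move=> d0; have n0 : 0 <= d^-1 * `|v - u| by rewrite mulr_ge0 ?invr_ge0 ?(ltW d0).
have [h|h] := leP v (y + d); first by rewrite ler_wpDr // ler_nat; case: (u <= y).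
rewrite [X in _ <= X + _]mulr0n add0r; have [h'|_] := leP u y; last exact: n0.
by rewrite ler_pdivlMl // mulr1; apply: le_trans (ler_norm _); lra.
Qed.

End Counting.

(** * Comparison of $F_N$ with the distribution function of one block $[0,q^K)$ *)

Section Blocks.
Variables (R : realType) (q : nat).
Hypothesis q2 : (2 <= q)%N.
Variable f : nat -> R.
Hypothesis hf : q_additive q f.

(** [indicator_shift] is summed over $n=aq^K+m$, with $f(n)$ and $f(m)$ in the two roles; they
    differ by $f(aq^K)$, whatever $m$ is. *)
Lemma count_blocks (K A : nat) (y d : R) : 0 < d ->
  let e := (q ^ K)%:R * (d^-1 * \sum_(0 <= a < A) `|f (a * q ^ K)%N|) in
  count_le R f (A * q ^ K) y <= A%:R * count_le R f (q ^ K) (y + d) + e /\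
  A%:R * count_le R f (q ^ K) (y - d) <= count_le R f (A * q ^ K) y + e.
Proof.
move=> d0 e.
have -> : e = \sum_(0 <= a < A) \sum_(0 <= m < q ^ K) (d^-1 * `|f (a * q ^ K)%N|).
  rewrite /e !mulr_sumr; apply: eq_bigr => a _.
  by rewrite sum_const_nat.
rewrite -!sum_const_nat /count_le sum_blocks -!big_split /=.
split; apply: ler_sum => a _; rewrite -big_split /=; apply: ler_sum_nat => m /=;
  rewrite ?leq0n /= => hm; rewrite (q_additive_split _ _ q2 _ hf) //.
- apply: le_trans (indicator_shift _ _ (f m) y d d0) _.
  by rewrite opprD addrCA subrr addr0 normrN.
- apply: le_trans (indicator_shift _ _ (f (a * q ^ K)%N + f m) (y - d) d d0) _.
  by rewrite subrK addrK.
Qed.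

Definition block_bound (K m : nat) : R :=
  `|\sum_(0 <= j < m) digit_sum R q f (K + j)| +
  Num.sqrt (\sum_(0 <= j < m) digit_sqr R q f (K + j)).

Lemma block_bound_ge0 (K m : nat) : 0 <= block_bound K m.
Proof. by rewrite addr_ge0 ?sqrtr_ge0. Qed.

Lemma qX_gt0 (K : nat) : (0 < q ^ K)%N.
Proof. by rewrite expn_gt0; lia. Qed.

Lemma distr_blocks (K m : nat) (y d : R) : 0 < d ->
  distr_fun f (q ^ (m + K)) y <=
    distr_fun f (q ^ K) (y + d) + d^-1 * block_bound K m /\
  distr_fun f (q ^ K) (y - d) <=
    distr_fun f (q ^ (m + K)) y + d^-1 * block_bound K m.
Proof.
move=> d0; have [] := count_blocks K (q ^ m) y d d0.
rewrite -expnD !count_leE ?qX_gt0 // [(q ^ (m + K))%:R](_ : _ = (q ^ m)%:R * (q ^ K)%:R);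
  last by rewrite expnD natrM.
have pK : (0 : R) < (q ^ K)%:R by rewrite ltr0n qX_gt0.
have pm : (0 : R) < (q ^ m)%:R by rewrite ltr0n qX_gt0.
have hE : (q ^ K)%:R * (d^-1 * \sum_(0 <= a < q ^ m) `|f (a * q ^ K)%N|) <=
    (q ^ m)%:R * (q ^ K)%:R * (d^-1 * block_bound K m).
  rewrite [X in _ <= X](_ : _ =
    (q ^ K)%:R * (d^-1 * ((q ^ m)%:R * block_bound K m))); last by ring.
  rewrite ler_wpM2l // ler_wpM2l ?invr_ge0 ?(ltW d0) //.
  exact: sum_norm_block.
have p : (0 : R) < (q ^ m)%:R * (q ^ K)%:R by exact: mulr_gt0.
by move=> h1 h2; split; rewrite -(ler_pM2l p); lra.
Qed.

(* [0, N) consists of [N %/ q ^ K < q ^ (l - K).+1] full blocks, whence the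
   extra factor [q], and of fewer than [q ^ K] further elements. *)
Lemma distr_truncated (N K l : nat) (y d : R) : 0 < d -> (K <= l)%N ->
  (q ^ l <= N < q ^ l.+1)%N ->
  let e := q%:R * (d^-1 * block_bound K (l - K).+1) + (q ^ (l - K))%:R^-1 in
  distr_fun f N y <= distr_fun f (q ^ K) (y + d) + e /\
  distr_fun f (q ^ K) (y - d) <= distr_fun f N y + e.
Proof.
move=> d0 Kl /andP[lN Nl] e.
have N0 : (0 < N)%N by apply: leq_trans lN; exact: qX_gt0.
set A := (N %/ q ^ K)%N.
have AN : (A * q ^ K <= N)%N by exact: leq_trunc_div.
have hr : (N - A * q ^ K < q ^ K)%N.
  by rewrite {1}(divn_eq N (q ^ K)) addKn ltn_pmod // qX_gt0.
have hA : (A <= q ^ (l - K).+1)%N.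
  rewrite ltnW // /A ltn_divLR ?qX_gt0 // -expnD.
  by rewrite addSn subnK.
have pN : (0 : R) < N%:R by rewrite ltr0n.
have pK : (0 : R) < (q ^ K)%:R by rewrite ltr0n qX_gt0.
have ph : (0 : R) < (q ^ (l - K))%:R by rewrite ltr0n qX_gt0.
set S := \sum_(0 <= a < A) `|f (a * q ^ K)%N|.
pose B := block_bound K (l - K).+1.
have hS : S <= (q ^ (l - K).+1)%:R * B.
  apply: le_trans (sum_norm_block _ _ q2 _ hf K (l - K).+1).
  rewrite (big_cat_nat (n := A) (p := (q ^ _)%N)) //= lerDl.
  exact: sumr_ge0.
have lNR : (q ^ K)%:R * (q ^ (l - K))%:R <= N%:R :> R.
  by rewrite -natrM -expnD subnKC // ler_nat.
have B0 : 0 <= B by exact: block_bound_ge0.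
have e1 : (q ^ K)%:R * (d^-1 * S) <= N%:R * (q%:R * (d^-1 * B)).
  apply: (@le_trans _ _ ((q ^ K)%:R * (d^-1 * ((q ^ (l - K).+1)%:R * B)))).
    by rewrite ler_wpM2l // ler_wpM2l // invr_ge0 ltW.
  rewrite expnS natrM [X in X <= _](_ : _ =
    ((q ^ K)%:R * (q ^ (l - K))%:R) * (q%:R * (d^-1 * B))); last by ring.
  by rewrite ler_wpM2r // !mulr_ge0 // invr_ge0 ltW.
have e2 : (q ^ K)%:R <= N%:R * (q ^ (l - K))%:R^-1 :> R.
  by rewrite ler_pdivlMr.
have [c1 c2] := count_blocks K A y d d0.
have /andP[c3 c4] := count_le_cat R f _ _ y AN.
have c5 : (N - A * q ^ K)%:R <= (q ^ K)%:R :> R by rewrite ler_nat ltnW.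
have c6 : N%:R = A%:R * (q ^ K)%:R + (N - A * q ^ K)%:R :> R.
  by rewrite -natrM -natrD subnKC.
rewrite -/S in c1 c2.
rewrite (count_leE _ _ (q ^ K)) ?qX_gt0 // in c1.
rewrite (count_leE _ _ (q ^ K)) ?qX_gt0 // in c2.
rewrite (count_leE _ _ N) // in c3 c4.
have c7 := distr_fun_ge0 R f (q ^ K) (y + d).
have c8 := distr_fun_le1 R f (q ^ K) (y - d).
have c9 : (0 : R) <= (N - A * q ^ K)%:R by rewrite ler0n.
(* Passing from $Aq^K$ to $N$ elements is free in the upper bound; in the lower one it costs the
   incomplete block, as a distribution function is at most 1. *)
split; rewrite -(ler_pM2l pN) /e -/B.
  have : N%:R * distr_fun f (q ^ K) (y + d) >=
         A%:R * (q ^ K)%:R * distr_fun f (q ^ K) (y + d).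
    by rewrite ler_wpM2r // c6 lerDl.
  lra.
have : N%:R * distr_fun f (q ^ K) (y - d) <=
         A%:R * (q ^ K)%:R * distr_fun f (q ^ K) (y - d) + (N - A * q ^ K)%:R.
  by rewrite c6 mulrDl lerD2l ler_piMr.
lra.
Qed.

End Blocks.

(** * Tails of convergent series *)

Section Tails.
Variables (R : realType) (g : nat -> R).

Definition tail (K : nat) : R := limn (series g) - series g K.

Lemma sum_tail (K m : nat) :
  \sum_(0 <= j < m) g (K + j)%N = series g (m + K)%N - series g K.
Proof. by rewrite sub_series_geq ?leq_addl // addnC (sum_nat_shift _ K). Qed.

Lemma tail_split (K m : nat) :
  tail K = \sum_(0 <= j < m) g (K + j)%N + tail (m + K).
Proof. by rewrite sum_tail /tail; ring. Qed.

Hypothesis cvg_g : cvgn (series g).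

Lemma cvg_tail (K : nat) : \sum_(0 <= j < m) g (K + j)%N @[m --> \oo] --> tail K.
Proof.
under eq_fun do rewrite sum_tail.
apply: cvgB; last exact: cvg_cst.
by rewrite (cvg_shiftn K (series g)).
Qed.

(** The predicate is arbitrary because the theorem states its index conditions as integer
    comparisons with $L$ and $L-h$. *)
Lemma tailE (K : nat) (P : pred nat) : (forall j, P j = (K <= j)%N) ->
  \big[+%R/0]_(0 <= j <oo | P j) g j = tail K.
Proof.
move=> hP.
have E m : \sum_(0 <= j < m + K | P j) g j = \sum_(0 <= j < m) g (K + j)%N.
  rewrite -(sum_nat_shift _ K) addnC (big_cat_nat (n := K)) ?leq_addr //=.
  rewrite [X in X + _](_ : _ = 0) ?add0r; last first.
    by rewrite big_nat_cond big_pred0 // => j; rewrite hP; lia.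
  rewrite big_nat_cond [RHS]big_nat_cond; apply: eq_bigl => j.
  by rewrite hP; lia.
apply: cvg_lim => //; rewrite -(cvg_shiftn K).
under eq_fun do rewrite E.
exact: cvg_tail.
Qed.

Lemma partial_le_tail (K m : nat) : (forall j, 0 <= g j) ->
  \sum_(0 <= j < m) g (K + j)%N <= tail K.
Proof.
move=> g0; rewrite -(cvg_lim _ (cvg_tail K)) //.
apply: (@nondecreasing_cvgn_le _ (fun m => \sum_(0 <= j < m) g (K + j)%N)).
  move=> a b ab; rewrite [leRHS](big_cat_nat (n := a)) //= lerDl.
  exact: sumr_ge0.
by apply/cvg_ex; exists (tail K); exact: cvg_tail.
Qed.

End Tails.

(** * The limiting distribution and its concentration function *)

Section Limit.
Variables (R : realType) (q : nat).
Hypothesis q2 : (2 <= q)%N.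
Variable f : nat -> R.
Hypothesis hf : q_additive q f.
Hypothesis cvg_sum : cvgn (series (digit_sum R q f)).
Hypothesis cvg_sqr : cvgn (series (digit_sqr R q f)).
Variable F : R -> R.
Hypothesis hF : forall y : R, distr_fun f N y @[N --> \oo] --> F y.

Local Notation tsum := (tail R (digit_sum R q f)).
Local Notation tsqr := (tail R (digit_sqr R q f)).

Definition tail_bound (K : nat) : R := `|tsum K| + Num.sqrt (tsqr K).

Lemma tail_bound_ge0 (K : nat) : 0 <= tail_bound K.
Proof. by rewrite addr_ge0 ?sqrtr_ge0. Qed.

Lemma cvg_block_bound (K : nat) :
  block_bound R q f K m @[m --> \oo] --> tail_bound K.
Proof.
apply: cvgD; first by apply: cvg_norm; exact: cvg_tail.
by apply: continuous_cvg; [exact: sqrt_continuous | exact: cvg_tail].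
Qed.

Lemma cvg_distr_pow (K : nat) (y : R) :
  distr_fun f (q ^ (m + K)) y @[m --> \oo] --> F y.
Proof.
apply: (@cvg_comp _ _ _ (fun m => q ^ (m + K))%N (distr_fun f ^~ y) _ \oo _ _ (hF y)).
apply/cvgnyPge => A; near=> m.
apply: (@leq_trans (m + K)); last by rewrite ltnW // ltn_expl.
by rewrite (@leq_trans m) ?leq_addr //; near: m; exact: nbhs_infty_ge.
Unshelve. all: by end_near. Qed.

(** This is [distr_blocks] as $m\to\infty$ with $K$ fixed, along the subsequence $q^{m+K}$. *)
Lemma limit_blocks (K : nat) (y d : R) : 0 < d ->
  F y <= distr_fun f (q ^ K) (y + d) + d^-1 * tail_bound K /\
  distr_fun f (q ^ K) (y - d) <= F y + d^-1 * tail_bound K.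
Proof.
move=> d0.
have cB : d^-1 * block_bound R q f K m @[m --> \oo] --> d^-1 * tail_bound K.
  by apply: cvgMr; exact: cvg_block_bound.
split.
- apply: (ler_cvg_to (cvg_distr_pow K y) (cvgD (cvg_cst _) cB)).
  by near=> m; have [] := distr_blocks _ _ q2 _ hf K m y d d0.
- apply: (ler_cvg_to (cvg_cst _) (cvgD (cvg_distr_pow K y) cB)).
  by near=> m; have [] := distr_blocks _ _ q2 _ hf K m y d d0.
Unshelve. all: by end_near. Qed.

Lemma limit_homo : {homo F : x y / x <= y}.
Proof.
move=> x y xy; apply: (ler_cvg_to (hF x) (hF y)).
by near=> N; exact: distr_fun_homo.
Unshelve. all: by end_near. Qed.

Lemma limit_ge0 (y : R) : 0 <= F y.
Proof.
apply: (cvgr_to_ge (hF y)); near=> N; exact: distr_fun_ge0.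
Unshelve. all: by end_near. Qed.

Lemma limit_le1 (y : R) : F y <= 1.
Proof.
apply: (cvgr_to_le (hF y)); near=> N; exact: distr_fun_le1.
Unshelve. all: by end_near. Qed.

(** Quantitative form of [F] not being constant. For $K=0$ the block is $\{0\}$, whose distribution
    function is the unit step at 0; for large $d$ the error is at most $1/4$ on each side. *)
Lemma limit_increase_half : exists2 d : R, 0 < d & F (- 2 * d) + 1 / 2 <= F d.
Proof.
pose D := tail_bound 0; have D0 : 0 <= D := tail_bound_ge0 0.
pose d := 4 * D + 1; have d0 : 0 < d by rewrite /d; lra.
have dD : d^-1 * D <= 1 / 4 by rewrite ler_pdivrMl // /d; lra.
have G y : distr_fun f (q ^ 0) y = (0 <= y)%R%:R.
  rewrite distr_funE /count_le expn0 big_nat1 invr1 mul1r.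
  by rewrite (q_additive0 _ _ _ hf).
exists d => //.
have [h1 _] := limit_blocks 0 (- 2 * d) d d0.
have [_ h2] := limit_blocks 0 d d d0.
move: h1 h2; rewrite !G subrr lexx -/D.
(* The point $-2d$ is chosen so that after the shift by $d$ it is still strictly left of the
   step. *)
have -> : (0 <= - 2 * d + d) = false by apply/negbTE; rewrite -ltNge; lra.
rewrite /= mulr0n mulr1n; lra.
Qed.

(** The supremum is a genuine one, since [F] takes values in $[0,1]$. *)
Lemma concentration_ge (t z : R) : F (z + t) - F z <= concentration F t.
Proof.
apply: ub_le_sup; last by exists z.
exists 1 => _ [w _ <-].
by have := limit_le1 (w + t); have := limit_ge0 w; lra.
Qed.

Lemma concentration_ge0 (t : R) : 0 <= t -> 0 <= concentration F t.
Proof.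
move=> t0; apply: le_trans (concentration_ge t 0).
by rewrite subr_ge0 limit_homo // lerDl.
Qed.

Lemma concentration_mul (n : nat) (t z : R) :
  F (z + n%:R * t) - F z <= n%:R * concentration F t.
Proof.
elim: n => [|n IH]; first by rewrite !mul0r addr0 subrr.
have := concentration_ge t (z + n%:R * t).
rewrite -addrA -[X in n%:R * t + X]mul1r -mulrDl natr1.
by rewrite -[in X in _ -> _ <= X]natr1 mulrDl mul1r; lra.
Qed.

(** Steps of length $1/T$, about $3dT$ in number, cover $[-2d,d]$, where [F] grows by at least
    $1/2$; so one of them carries $\gg 1/T$. The constant depends on $f$ through $d$. *)
Lemma inv_le_concentration : exists2 c : R, 0 < c &
  forall T : R, 1 <= T -> 1 / T <= c * concentration F (1 / T).
Proof.
have [d d0 hd] := limit_increase_half.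
exists (2 * (3 * d + 1)); first by lra.
move=> T T1; have T0 : 0 < T by lra.
have dT0 : 0 <= 3 * d * T by rewrite !mulr_ge0 // ltW.
have /andP[n1 n2] := truncn_itv dT0.
set n := Num.trunc _ in n1 n2.
have := concentration_mul n.+1 (1 / T) (- 2 * d).
set Q := concentration F (1 / T).
have Q0 : 0 <= Q by rewrite concentration_ge0 // divr_ge0 // ltW.
have hle : F d <= F (- 2 * d + n.+1%:R * (1 / T)).
  apply: limit_homo; rewrite mulrA mulr1 -lerBlDl ler_pdivlMr //.
  by apply: ltW; apply: le_lt_trans n2; lra.
(* Here $n+1\leqslant 3dT+1\leqslant(3d+1)T$, by $T\geqslant1$. *)
have hn : n.+1%:R * Q <= (3 * d + 1) * T * Q.
  by rewrite ler_wpM2r // -natr1; lra.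
by move=> h; rewrite ler_pdivrMr //; lra.
Qed.

(** One shift by $1/T$ leads from $F_N$ to the block $[0,q^K)$ and a second one from there to [F];
    undoing both costs [2 * concentration F (1 / T)]. *)
Lemma distr_dist (N K l : nat) (y T : R) : 0 < T -> (K <= l)%N ->
  (q ^ l <= N < q ^ l.+1)%N ->
  `|distr_fun f N y - F y| <= 2 * concentration F (1 / T) + T * tail_bound K +
     (q%:R * (T * block_bound R q f K (l - K).+1) + (q ^ (l - K))%:R^-1).
Proof.
move=> T0 Kl hN.
have d0 : 0 < 1 / T by rewrite divr_gt0.
have [a1 a2] := distr_truncated _ _ q2 _ hf N K l y (1 / T) d0 Kl hN.
have [_ b2] := limit_blocks K (y + 2 * (1 / T)) (1 / T) d0.
have [b1 _] := limit_blocks K (y - 2 * (1 / T)) (1 / T) d0.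
have c1 := concentration_mul 2 (1 / T) y.
have c2 := concentration_mul 2 (1 / T) (y - 2 * (1 / T)).
rewrite div1r invrK in a1 a2 b1 b2; rewrite div1r in c1 c2 *.
rewrite (_ : y + 2 * T^-1 - T^-1 = y + T^-1) in b2; last by ring.
rewrite (_ : y - 2 * T^-1 + T^-1 = y - T^-1) in b1; last by ring.
rewrite subrK in c2.
by rewrite ler_norml; apply/andP; split; lra.
Qed.

(** * Error terms in the form of the theorem, for $K=L-h$ *)

Section Bounds.
Variables (K h : nat).
Hypothesis h1 : (1 <= h)%N.

Let E : R := Num.sqrt h%:R * Num.sqrt (tsqr K).

Lemma tsqr_ge0 : 0 <= tsqr K.
Proof.
have := partial_le_tail _ _ cvg_sqr K 0 (digit_sqr_ge0 _ _ _).
by rewrite big_geq.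
Qed.

Lemma sqrt_tsqr_le : Num.sqrt (tsqr K) <= E.
Proof.
rewrite /E ler_peMl ?sqrtr_ge0 // -[leLHS]sqrtr1 ler_sqrt ?ler0n //.
by rewrite ler1n.
Qed.

Lemma head_sum_le :
  `|\sum_(0 <= j < h.+1) digit_sum R q f (K + j)| <= 2 * q%:R * E.
Proof.
apply: le_trans (digit_sum_CS _ _ _ K h.+1) _.
rewrite /E -sqrtrM // -[2 * q%:R]ger0_norm ?mulr_ge0 // -sqrtr_sqr.
rewrite -sqrtrM ?sqr_ge0 // ler_sqrt; last first.
  by rewrite mulr_ge0 ?sqr_ge0 // mulr_ge0 // tsqr_ge0.
rewrite [leRHS]mulrA ler_pM //.
- by rewrite sumr_ge0 // => j _; exact: digit_sqr_ge0.
(* The constant: $(h+1)q\leqslant(2q)^2h$, as $h\geqslant1$. *)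
- by rewrite -[2]/(2%:R) -!natrM -natrX -natrM ler_nat; nia.
- exact: partial_le_tail cvg_sqr _ _ (digit_sqr_ge0 _ _ _).
Qed.

Lemma block_bound_le : block_bound R q f K h.+1 <= (2 * q%:R + 1) * E.
Proof.
rewrite mulrDl mul1r lerD ?head_sum_le //; apply: le_trans sqrt_tsqr_le.
rewrite ler_sqrt ?tsqr_ge0 //.
exact: partial_le_tail cvg_sqr _ _ (digit_sqr_ge0 _ _ _).
Qed.

(** The signed tail from $K$ is cut after $h+1$ positions: Cauchy-Schwarz handles these, and for
    $K=L-h$ what remains is the sum over $j>L$. *)
Lemma tail_bound_le :
  tail_bound K <= `|tsum (h.+1 + K)| + (2 * q%:R + 1) * E.
Proof.
rewrite /tail_bound (tail_split _ _ K h.+1) mulrDl mul1r.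
have := ler_normD (\sum_(0 <= j < h.+1) digit_sum R q f (K + j)) (tsum (h.+1 + K)).
have := head_sum_le; have := sqrt_tsqr_le; lra.
Qed.

End Bounds.
End Limit.

(** * Logarithms and the final estimate *)

Lemma log_floor (R : realType) (q N l : nat) : (2 <= q)%N -> (1 <= N)%N ->
  Num.floor (log_base q (N%:R : R)) = l%:Z -> (q ^ l <= N < q ^ l.+1)%N.
Proof.
move=> q2 N1 hl.
have lq : 0 < ln (q%:R : R) by rewrite ln_gt0 // ltr1n.
have pos n : (0 < n)%N -> (n%:R : R) \is Num.pos by rewrite posrE ltr0n.
have qn n : (0 < q ^ n)%N by rewrite expn_gt0; lia.
have := floor_itv (log_base q (N%:R : R)).
rewrite hl /log_base ler_pdivlMr // ltr_pdivrMr // intrD -pmulrn natr1.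
have E n : ln ((q ^ n)%:R : R) = n%:R * ln q%:R.
  by rewrite natrX lnXn ?mulr_natl // ltr0n; lia.
by rewrite -!E ler_ln ?pos // ltr_ln ?pos // ler_nat ltr_nat.
Qed.

Theorem theorem2 (R : realType) (q : nat) (hq : (2 <= q)%N)
  (f : nat -> R) (hf : q_additive q f)
  (hsum1 : cvgn (series (fun j : nat =>
     \sum_(1 <= d < q) f (d * q ^ j)%N)))
  (hsum2 : cvgn (series (fun j : nat =>
     \sum_(1 <= d < q) f (d * q ^ j)%N ^+ 2)))
  (hinf : infinite_set [set p : nat * nat |
     (1 <= p.1 <= q.-1)%N /\ f (p.1 * q ^ p.2)%N <> 0])
  (F : R -> R)
  (hF : forall y : R, distr_fun f N y @[N --> \oo] --> F y) :
  exists C : R, 0 < C /\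
    forall (N : nat) (T : R), (1 <= N)%N -> 1 <= T ->
      let L : int := Num.floor (log_base q (N%:R : R)) in
      let h : int := Num.ceil (log_base q (T * ln T)) in
      h <= L ->
      sup_norm (fun y => distr_fun f N y - F y) <=
        C * (concentration F (1 / T)
             + T * `| \big[+%R/0]_(0 <= j <oo | L < j%:Z)
                        \sum_(0 <= d < q) f (d * q ^ j)%N |
             + T * Num.sqrt (h%:~R : R)
                 * Num.sqrt (\big[+%R/0]_(0 <= j <oo | L - h <= j%:Z)
                               \sum_(0 <= d < q) f (d * q ^ j)%N ^+ 2)).
Proof.
have f0 := q_additive0 _ _ _ hf.
(* The hypotheses sum from $d=1$, [digit_sum] and [digit_sqr] from $d=0$; the extra term is
   $f(0)=0$. *)
have cS : cvgn (series (digit_sum R q f)).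
  suff -> : digit_sum R q f = fun j => \sum_(1 <= d < q) f (d * q ^ j)%N by [].
  apply/funext => j.
  by rewrite /digit_sum big_ltn ?mul0n ?f0 ?add0r //; lia.
have cQ : cvgn (series (digit_sqr R q f)).
  suff -> : digit_sqr R q f = fun j => \sum_(1 <= d < q) f (d * q ^ j)%N ^+ 2.
    by [].
  apply/funext => j.
  by rewrite /digit_sqr big_ltn ?mul0n ?f0 ?expr0n ?add0r //; lia.
have [c c0 hc] := inv_le_concentration _ _ hq _ hf cS cQ _ hF.
have Q0 T := concentration_ge0 _ _ _ hF (1 / T).
have eT : 1 < expR 1 :> R by rewrite expR_gt1.
(* The 2 pays for the two shifts; $ec$ for the incomplete block and for the range $T<e$; the product
   for the square-root term, once from [tail_bound] and $q$ times from [block_bound]. *)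
pose C : R := 2 + expR 1 * c + (q%:R + 1) * (2 * q%:R + 1).
have q0 : 0 <= q%:R :> R by [].
have ec0 : 0 <= expR 1 * c by rewrite mulr_ge0 ?expR_ge0 // ltW.
have qq0 : 0 <= (q%:R + 1) * (2 * q%:R + 1) :> R.
  by rewrite mulr_ge0 // addr_ge0 // mulr_ge0.
have C0 : 0 < C by rewrite /C; lra.
exists C; split=> // N T N1 T1 L h hL.
have T0 : 0 < T by lra.
set S1 := `|_|; set S2 := Num.sqrt (limn _).
have X0 : 0 <= T * S1 by rewrite mulr_ge0 ?(ltW T0) ?normr_ge0.
have Y0 : 0 <= T * Num.sqrt h%:~R * S2 by rewrite !mulr_ge0 ?sqrtr_ge0 ?(ltW T0).
have {}Q0 := Q0 T (divr_ge0 ler01 (ltW T0)).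
apply: ge_sup; first by exists `|distr_fun f N 0 - F 0|; exists 0.
move=> _ [y _ <-].
have {}hc := hc T T1.
set Q := concentration F _ in Q0 hc *.
(* For $T<e$, where [h] may be zero or negative, the left side is at most $1\leqslant e/T\leqslant
   ecQ$. *)
have [Te|Te] := ltP T (expR 1).
  have F0 := limit_ge0 _ _ _ hF y; have F1 := limit_le1 _ _ _ hF y.
  have D0 := distr_fun_ge0 R f N y; have D1 := distr_fun_le1 R f N y.
  apply: (@le_trans _ _ 1); first by rewrite ler_norml; apply/andP; split; lra.
  have h1 : 1 <= expR 1 * (c * Q).
    apply: (@le_trans _ _ (expR 1 * (1 / T))); first by rewrite mulrA mulr1 ler_pdivlMr //; lra.
    by rewrite ler_wpM2l ?expR_ge0.
  apply: (le_trans h1); rewrite mulrA.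
  by apply: ler_pM => //; rewrite /C; lra.
(* From $T\geqslant e$ follow $T\leqslant T\log T\leqslant q^h$ and $h\geqslant1$. *)
have lnT : 1 <= ln T by rewrite -[leLHS](expRK 1) ler_ln ?posrE ?expR_gt0.
have TlnT : T <= T * ln T by rewrite ler_peMr // ltW.
have lq : 0 < ln (q%:R : R) by rewrite ln_gt0 // ltr1n.
have hpos : 0 < h.
  rewrite ltNge ceil_le0 -ltNge divr_gt0 // ln_gt0 //; lra.
have hge0 : 0 <= h by exact: ltW.
have [l El] : exists l : nat, L = l%:Z.
  by exists `|L|%N; rewrite gez0_abs // (le_trans hge0).
have [k Ek] : exists k : nat, h = k%:Z by exists `|h|%N; rewrite gez0_abs.
have kl : (k <= l)%N by move: hL; rewrite El Ek lez_nat.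
have k1 : (1 <= k)%N by move: hpos; rewrite Ek ltz_nat.
have hN := log_floor _ _ _ _ hq N1 El.
have Thk : T <= (q ^ k)%:R.
  apply: (le_trans TlnT).
  have := ceil_ge (log_base q (T * ln T)); rewrite -/h Ek /log_base.
  have q00 : (0 : R) < q%:R by rewrite ltr0n ltnW.
  rewrite ler_pdivrMr // -pmulrn natrX mulr_natl -lnXn //.
  by rewrite ler_ln // posrE ?exprn_gt0 // (lt_le_trans T0).
have Kl : (l - k <= l)%N by exact: leq_subr.
have S1E : S1 = `|tail R (digit_sum R q f) l.+1|.
  by congr `|_|; apply: tailE => // j; rewrite El ltz_nat.
have S2E : S2 = Num.sqrt (tail R (digit_sqr R q f) (l - k)).
  by congr Num.sqrt; apply: tailE => // j; rewrite El Ek subzn // lez_nat.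
have hE : Num.sqrt h%:~R = Num.sqrt k%:R :> R by rewrite Ek -pmulrn.
have := distr_dist _ _ hq _ hf cS cQ _ hF N (l - k) l y T T0 Kl hN.
rewrite -/Q subKn //.
have := block_bound_le _ _ hq _ cQ (l - k) k k1.
have := tail_bound_le _ _ hq _ cQ (l - k) k k1.
rewrite (_ : k.+1 + (l - k) = l.+1)%N; last by rewrite addSn subnKC.
rewrite -S1E -S2E -hE => h1 h2 h3; apply: (le_trans h3).
set W := Num.sqrt _ * S2 in h1 h2 *.
have W0 : 0 <= W by rewrite mulr_ge0 ?sqrtr_ge0.
have {}h1 : T * tail_bound R q f (l - k) <= T * (S1 + (2 * q%:R + 1) * W).
  by rewrite ler_pM2l.
have {}h2 : q%:R * (T * block_bound R q f (l - k) k.+1) <=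
    q%:R * (T * ((2 * q%:R + 1) * W)).
  by rewrite ler_wpM2l // ler_pM2l.
have h4 : (q ^ k)%:R^-1 <= c * Q.
  by apply: le_trans hc; rewrite div1r lef_pV2 ?posrE // (lt_le_trans T0).
have h5 : c * Q <= expR 1 * c * Q.
  by rewrite -mulrA ler_peMl ?(ltW eT) ?mulr_ge0 ?(ltW c0).
rewrite -[T * _ * S2]mulrA -/W in Y0 *.
(* [g2], [g3] and [g4] are the surplus products when [C] is multiplied out over the three terms;
   they are supplied to [lra] as nonnegative. *)
have g1 : 0 <= expR 1 * c * Q by rewrite mulr_ge0.
have g2 : 0 <= (q%:R + 1) * (2 * q%:R + 1) * Q by rewrite mulr_ge0.
have g3 : 0 <= (C - 1) * (T * S1) by rewrite mulr_ge0 // /C; lra.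
have g4 : 0 <= (2 + expR 1 * c) * (T * W) by rewrite mulr_ge0 //; lra.
rewrite /C in g3 *; lra.
Qed.
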